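(* Let $X$ be a normal ($T_4$) topological space. For any $Z_B$-filter $\mathscr F$ on $X$, $E_B^{-1}(\mathscr F)$ is an $e_B$-ideal in $B_1^*(X)$.
   Context: A Baire one function on $X$ is a function $f:X\to\mathbb{R}$ that is the pointwise limit of a sequence of continuous real-valued functions on $X$. $B_1(X)$ is the ring, under pointwise operations, of all Baire one functions on $X$, and $B_1^*(X)$ is its subring of bounded functions. For $f\in B_1(X)$, $Z(f)=\{x\in X: f(x)=0\}$, and $Z(B_1(X))=\{Z(f): f\in B_1(X)\}$. A $Z_B$-filter on $X$ is a nonempty $\mathscr F\subseteq Z(B_1(X))$ such that (1) $\emptyset\notin\mathscr F$; (2) $Z_1,Z_2\in\mathscr F$ implies $Z_1\cap Z_2\in\mathscr F$; (3) $Z\in\mathscr F$, $Z'\in Z(B_1(X))$ and $Z\subseteq Z'$ imply $Z'\in\mathscr F$. For $f\in B_1^*(X)$ and $\epsilon>0$, $E_B^\epsilon(f)=\{x\in X: |f(x)|\le\epsilon\}$ (a member of $Z(B_1(X))$). For nonempty $I\subseteq B_1^*(X)$, $E_B(I)=\{E_B^\epsilon(f): f\in I,\ \epsilon>0\}$. For $\mathscr F\subseteq Z(B_1(X))$, $E_B^{-1}(\mathscr F)=\{f\in B_1^*(X): E_B^\epsilon(f)\in\mathscr F\text{ for all }\epsilon>0\}$. An ideal $I$ of $B_1^*(X)$ is an $e_B$-ideal if $I=E_B^{-1}(E_B(I))$. *)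

(* Defs.v *)
From HB Require Import structures.
From mathcomp Require Import all_boot all_order all_algebra.
From mathcomp Require Import all_classical all_reals all_analysis.

Set Implicit Arguments.
Unset Strict Implicit.
Unset Printing Implicit Defensive.

Import Order.TTheory GRing.Theory Num.Theory.
Import numFieldNormedType.Exports.

Local Open Scope classical_set_scope.
Local Open Scope ring_scope.

Definition T4_space (X : topologicalType) : Prop :=
  @accessible_space X /\ @normal_space X.

(* Ideals need not be proper, unlike in mathcomp's [idealr_closed]. *)
Definition is_ideal (A : comPzRingType) (I : set A) : Prop :=
  [/\ I !=set0,
      forall u v, I u -> I v -> I (u - v) &
      forall a u, I u -> I (a * u)].

Section BaireOne.
Context (R : realType) (X : topologicalType).

Definition baire_one : set (X -> R) := [set f | exists2 g : nat -> X -> R,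
  forall n, continuous (g n) & forall x, g n x @[n --> \oo] --> f x].

Definition bounded_baire_one : {pred (X -> R)} :=
  mem (baire_one `&` [set f | bounded_fun f]).

Lemma baire_one_cst (c : R) : baire_one (cst c).
Proof.
exists (fun=> cst c) => [n x|x]; first exact: cvg_cst.
exact: cvg_cst.
Qed.

Lemma baire_oneB (f g : X -> R) :
  baire_one f -> baire_one g -> baire_one (f - g).
Proof.
move=> [u uc uf] [v vc vg]; exists (fun n => u n - v n) => [n x|x].
  by apply: cvgB; [exact: uc|exact: vc].
by apply: cvgB; [exact: uf|exact: vg].
Qed.

Lemma baire_oneM (f g : X -> R) :
  baire_one f -> baire_one g -> baire_one (f * g).
Proof.
move=> [u uc uf] [v vc vg]; exists (fun n => u n * v n) => [n x|x].
  by apply: cvgM; [exact: uc|exact: vc].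
by apply: cvgM; [exact: uf|exact: vg].
Qed.

Lemma bounded_funP (f : X -> R) :
  bounded_fun f <-> exists M, forall x, `|f x| <= M.
Proof.
split=> [[M [_ hM]]|[M hM]].
  by exists (M + 1) => x; apply: hM => //; rewrite ltrDl.
exists M; split; first exact: num_real.
by move=> N MN x _; exact: le_trans (hM x) (ltW MN).
Qed.

Lemma bounded_baire_one_subring : subring_closed bounded_baire_one.
Proof.
split=> [|f g|f g]; rewrite ?inE.
- split; first exact: baire_one_cst.
  by apply/bounded_funP; exists `|1 : R|.
- move=> [fB /bounded_funP[M hM]] [gB /bounded_funP[N hN]].
  split; first exact: baire_oneB.
  apply/bounded_funP; exists (M + N) => x.
  exact: le_trans (ler_normB _ _) (lerD (hM x) (hN x)).
- move=> [fB /bounded_funP[M hM]] [gB /bounded_funP[N hN]].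
  split; first exact: baire_oneM.
  apply/bounded_funP; exists (M * N) => x.
  rewrite [X in `|X|](_ : _ = f x * g x)// normrM.
  exact: ler_pM.
Qed.

HB.instance Definition _ :=
  GRing.isSubringClosed.Build (X -> R) bounded_baire_one
    bounded_baire_one_subring.

Record bbaire := BBaire {
  bbaire_fun :> X -> R;
  bbaire_funP : bbaire_fun \in bounded_baire_one
}.

HB.instance Definition _ := [isSub for bbaire_fun].
HB.instance Definition _ := [Choice of bbaire by <:].
HB.instance Definition _ :=
  GRing.SubChoice_isSubComPzRing.Build (X -> R) bounded_baire_one bbaire
    (subringClosedP bounded_baire_one).

Definition zero_set (f : X -> R) : set X := [set x | f x = 0].

Definition baire_zero_sets : set (set X) := zero_set @` baire_one.

Definition ZB_filter (F : set (set X)) : Prop :=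
  [/\ F !=set0,
      F `<=` baire_zero_sets,
      ~ F set0,
      forall Z1 Z2, F Z1 -> F Z2 -> F (Z1 `&` Z2) &
      forall Z Z', F Z -> baire_zero_sets Z' -> Z `<=` Z' -> F Z'].

Definition EB_eps (e : R) (f : X -> R) : set X := [set x | `|f x| <= e].

Definition EB (I : set bbaire) : set (set X) :=
  [set Z | exists f e, [/\ I f, 0 < e & Z = EB_eps e f]].

Definition EB_inv (F : set (set X)) : set bbaire :=
  [set f | forall e, 0 < e -> F (EB_eps e f)].

Definition eB_ideal (I : set bbaire) : Prop :=
  is_ideal I /\ I = EB_inv (EB I).

End BaireOne.

Arguments baire_zero_sets R X : clear implicits.
Arguments ZB_filter R {X} F.
Arguments EB_inv R {X} F.

(* Main.v *)
Require Import Defs.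
From mathcomp Require Import all_boot all_order all_algebra.
From mathcomp Require Import all_classical all_reals all_analysis.

Import Order.TTheory GRing.Theory Num.Theory.
Import numFieldNormedType.Exports.

Local Open Scope classical_set_scope.
Local Open Scope ring_scope.

(** [EB] and [EB_inv] are adjoint for inclusion: [EB I] lies in [F] exactly when [I] lies in
    [EB_inv R F]. The unit [EB_inv_EB_sup] and counit [EB_EB_inv_sub] then give the fixed-point
    equation for [EB_inv R F]. That this set is an ideal ([EB_inv_ideal]) comes from the filter
    axioms and the usual epsilon estimates, once the sets [EB_eps e f] are known to be Baire one
    zero sets. *)

Lemma baire_one_comp {R : realType} {X : topologicalType} (h : R -> R)
    (f : X -> R) :
  continuous h -> baire_one f -> baire_one (h \o f).
Proof.
move=> hc [g gc gf]; exists (fun n => h \o g n) => [n x|x].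
  by apply: continuous_comp; [exact: gc|exact: hc].
by apply: continuous_cvg; [exact: hc|exact: gf].
Qed.

(** The set is the zero set of [max(|f| - e, 0)], a continuous function of [f] and hence Baire
    one. *)
Lemma baire_zero_sets_EB_eps {R : realType} {X : topologicalType} (e : R)
    (f : X -> R) :
  baire_one f -> baire_zero_sets R X (EB_eps e f).
Proof.
move=> fB; exists ((fun t : R => Num.max (`|t| - e) 0) \o f).
  apply: baire_one_comp => // t.
  apply: (@continuous_max R R (fun t => `|t| - e) (cst 0)); last exact: cvg_cst.
  by apply: cvgB; [exact: norm_continuous|exact: cvg_cst].
apply/seteqP; split=> x; rewrite /zero_set /EB_eps /=.
  by move=> fx; rewrite -subr_le0 -fx le_max lexx.
by move=> fx; apply/max_idPr; rewrite subr_le0.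
Qed.

Lemma bbaire_baire_one {R : realType} {X : topologicalType} (f : bbaire R X) :
  baire_one f.
Proof. by have := bbaire_funP f; rewrite inE => -[]. Qed.

(** The bound is made strictly positive so that a tolerance can be divided by it. *)
Lemma bbaire_bounded {R : realType} {X : topologicalType} (f : bbaire R X) :
  exists2 M : R, 0 < M & forall x, `|f x| <= M.
Proof.
have := bbaire_funP f; rewrite inE => -[_ /Defs.bounded_funP[M fM]].
exists (Num.max M 1) => [|x]; first by rewrite lt_max ltr01 orbT.
by rewrite le_max fM.
Qed.

Lemma EB_inv_ideal (R : realType) (X : topologicalType) (F : set (set X)) :
  ZB_filter R F -> is_ideal (EB_inv R F).
Proof.
move=> [[Z FZ] _ _ FI FS].
(* Upward closure of [F], specialised to sets [EB_eps e f]: each ideal axiom reduces to an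
   inclusion. *)
have FE (W : set X) (f : bbaire R X) e :
    F W -> W `<=` EB_eps e f -> F (EB_eps e f).
  move=> FW; apply: FS => //.
  exact/baire_zero_sets_EB_eps/bbaire_baire_one.
split.
- exists 0 => e e0; apply: (FE _ _ _ FZ) => x _.
  by rewrite /EB_eps /= normr0 ltW.
- move=> u v Iu Iv e e0; have e20 : 0 < e / 2 by rewrite divr_gt0.
  apply: (FE _ _ _ (FI _ _ (Iu _ e20) (Iv _ e20))) => x [ux vx].
  have -> : e = e / 2 + e / 2 by rewrite -splitr.
  exact: le_trans (ler_normB (u x) (v x)) (lerD ux vx).
(* With [|a| <= M], tolerance [e / M] for [u] yields [e] for [a * u]. *)
- move=> a u Iu e e0; have [M M0 aM] := bbaire_bounded a.
  apply: (FE _ _ _ (Iu _ (divr_gt0 e0 M0))) => x ux.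
  rewrite /EB_eps /= [X in `|X|](_ : _ = a x * u x)// normrM.
  have -> : e = M * (e / M) by rewrite mulrC divfK// gt_eqF.
  exact: ler_pM.
Qed.

Lemma EB_EB_inv_sub (R : realType) (X : topologicalType) (F : set (set X)) :
  EB (EB_inv R F) `<=` F.
Proof. by move=> _ [f [e [If e0 ->]]]; exact: If. Qed.

Lemma EB_inv_EB_sup (R : realType) (X : topologicalType)
    (I : set (bbaire R X)) :
  I `<=` EB_inv R (EB I).
Proof. by move=> f If e e0; exists f, e. Qed.

Theorem theorem3p6 (R : realType) (X : topologicalType) (HX : T4_space X)
    (F : set (set X)) (HF : ZB_filter R F) :
  eB_ideal (EB_inv R F).
Proof.
split; first exact: EB_inv_ideal.
apply/seteqP; split; first exact: EB_inv_EB_sup.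
(* The counit puts every [EB_eps e f] back into [F]. *)
by move=> f If e e0; apply: (@EB_EB_inv_sub R); exact: If.
Qed.
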